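(* If $T$ is a tree, then $\alpha_{\rm es}(T)\geq \ell(T)-s(T)$, where equality holds if and only if $V(T)=S(T)\cup L(T)$ and $s(v) \leq \ell(v)-1$ for every $v\in S(T)$.
   Context: All graphs are finite and simple. For a graph $G$ and a vertex $v$, $N(v)$ is the set of neighbors of $v$ and $N[v]=N(v)\cup\{v\}$. For $B\subseteq V(G)$, $N[B]=\bigcup_{b\in B}N[b]$ and $N(B)=N[B]-B$. A set $B\subseteq V(G)$ is an externally supported independence set (ESI-set) if $B$ is independent and every $v\in N(B)$ has a neighbor in $V(G)-N[B]$ (the empty set is an ESI-set); $\alpha_{\rm es}(G)$ is the maximum cardinality of an ESI-set of $G$. A leaf is a vertex of degree $1$, and the neighbor of a leaf is called its support vertex (in particular, both vertices of $K_2$ are leaves and support vertices). $L(T)$ is the set of all leaves of $T$ and $S(T)$ is the set of all support vertices of $T$; $\ell(T)=|L(T)|$ and $s(T)=|S(T)|$. For a vertex $v$, $\ell(v)$ is the number of leaves adjacent to $v$ and $s(v)$ is the number of support vertices adjacent to $v$.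
   Formalization: The characterization of equality is stated for every tree T other than K_2, since for K_2 equality holds (α_es = 0 = ℓ − s) although s(v) = 1 > ℓ(v) − 1 = 0; the inequality is stated for all trees. *)

(* Defs.v *)
From mathcomp Require Import all_boot all_order all_algebra.

Set Implicit Arguments.
Unset Strict Implicit.
Unset Printing Implicit Defensive.

(* A finite simple graph is an adjacency relation
   [e : rel V], symmetric and irreflexive, on a finite type [V]. *)
Definition simple_graph (V : finType) (e : rel V) : Prop :=
  symmetric e /\ irreflexive e.

(* [ucycle e c] also accepts the degenerate closed walks of length at most 2,
   e.g. [:: x; y] for an edge xy, hence the size condition. *)
Definition acyclic (V : finType) (e : rel V) : Prop :=
  forall c : seq V, 2 < size c -> ~ ucycle e c.

Definition connected (V : finType) (e : rel V) : Prop :=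
  0 < #|V| /\ forall x y : V, connect e x y.

Definition tree (V : finType) (e : rel V) : Prop :=
  [/\ simple_graph e, connected e & acyclic e].

Definition nbhd (V : finType) (e : rel V) (v : V) : {set V} :=
  [set u | e v u].

Definition closed_nbhd (V : finType) (e : rel V) (v : V) : {set V} :=
  v |: nbhd e v.

Definition set_closed_nbhd (V : finType) (e : rel V) (B : {set V}) : {set V} :=
  \bigcup_(b in B) closed_nbhd e b.

Definition set_nbhd (V : finType) (e : rel V) (B : {set V}) : {set V} :=
  set_closed_nbhd e B :\: B.

Definition independent (V : finType) (e : rel V) (B : {set V}) : bool :=
  [forall x in B, forall y in B, ~~ e x y].

Definition esi_set (V : finType) (e : rel V) (B : {set V}) : bool :=
  independent e B &&
  [forall v in set_nbhd e B,
     exists w in [set: V] :\: set_closed_nbhd e B, e v w].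

Definition alpha_es (V : finType) (e : rel V) : nat :=
  \max_(B : {set V} | esi_set e B) #|B|.

Definition leaves (V : finType) (e : rel V) : {set V} :=
  [set v | #|nbhd e v| == 1].

(* In K_2 each vertex is both a leaf and a support vertex, and there
   alpha_es = 0 = num_leaves - num_supports although
   num_supports_at v = num_leaves_at v = 1 for both vertices. *)
Definition supports (V : finType) (e : rel V) : {set V} :=
  [set v | [exists u in leaves e, e u v]].

Definition num_leaves (V : finType) (e : rel V) : nat := #|leaves e|.

Definition num_supports (V : finType) (e : rel V) : nat := #|supports e|.

Definition num_leaves_at (V : finType) (e : rel V) (v : V) : nat :=
  #|nbhd e v :&: leaves e|.

Definition num_supports_at (V : finType) (e : rel V) (v : V) : nat :=
  #|nbhd e v :&: supports e|.

(* Main.v *)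
(** If no leaf is a support vertex, deleting one leaf per support vertex from
    the set of leaves leaves an ESI-set of size at least [l - s].  Given a
    vertex [v] that is not a leaf, one may instead delete all leaves at [v]
    and one leaf per support vertex outside [N[v]]: support vertices adjacent
    to [v] then have [v] itself as external neighbor.  This gains
    [s(v) - l(v)], plus one if [v] is a support vertex.  Hence equality forces
    [s(v) < l(v)] at support vertices, and [s(v) = 0] at all vertices outside
    [S] and [L]; by connectivity there are then none of the latter.
    Conversely an ESI-set avoids [S], so it consists of leaves, and if it
    contains all leaves at [a] then [a] is adjacent to a support vertex [c]
    none of whose leaves are taken; the surplus [l(c) - 1 >= s(c)] of
    untaken leaves at [c] pays for all such neighbors [a]. *)
Require Import Defs.
From mathcomp Require Import all_boot all_order all_algebra zify.

Import Order.TTheory GRing.Theory Num.Theory.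
Local Open Scope ring_scope.

Section ExternallySupported.
Set Implicit Arguments.
Unset Strict Implicit.
Local Open Scope nat_scope.

(** * Leaves, support vertices and ESI-sets in general graphs *)

Lemma in_nbhd (V : finType) (e : rel V) (v u : V) : (u \in nbhd e v) = e v u.
Proof. by rewrite inE. Qed.

Lemma leaf_neighbor_uniq (V : finType) (e : rel V) (u x y : V) :
  u \in leaves e -> e u x -> e u y -> x = y.
Proof.
rewrite inE => /cards1P[z Nu]; rewrite -!(in_nbhd e) Nu !inE.
by move=> /eqP-> /eqP->.
Qed.

Lemma supportP (V : finType) (e : rel V) (v : V) :
  reflect (exists2 u, u \in leaves e & e u v) (v \in supports e).
Proof. by rewrite inE; apply: exists_inP. Qed.

Lemma set_closed_nbhdP (V : finType) (e : rel V) (B : {set V}) (v : V) :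
  reflect (v \in B \/ exists2 b, b \in B & e b v) (v \in set_closed_nbhd e B).
Proof.
apply: (iffP bigcupP) => [[b bB]|[vB|[b bB ebv]]].
- by rewrite !inE => /predU1P[->|ebv]; [left | right; exists b].
- by exists v; rewrite // !inE eqxx.
- by exists b; rewrite // !inE ebv orbT.
Qed.

Lemma esi_set_leq_alpha (V : finType) (e : rel V) (B : {set V}) :
  esi_set e B -> #|B| <= alpha_es e.
Proof. by move=> esiB; apply: leq_bigmax_cond. Qed.

Lemma alpha_es_attained (V : finType) (e : rel V) :
  exists2 B, esi_set e B & #|B| = alpha_es e.
Proof.
have esi0 : esi_set e set0.
  apply/andP; split; first by apply/forall_inP => x; rewrite in_set0.
  apply/forall_inP => x /setDP[/set_closed_nbhdP[]]; rewrite ?in_set0 //.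
  by case=> b; rewrite in_set0.
have [|B esiB aE] := eq_bigmax_cond (A := esi_set e) (fun B : {set V} => #|B|).
  by apply/card_gt0P; exists set0.
by exists B; rewrite // /alpha_es aE.
Qed.

(** * Lower bounds from ESI-sets made of leaves *)

Lemma esi_set_leaves (V : finType) (e : rel V) (B : {set V}) :
    symmetric e -> [disjoint supports e & leaves e] -> B \subset leaves e ->
    (forall w, w \in supports e ->
       exists x, [/\ e w x, x \notin B & forall y, y \in B -> ~~ e y x]) ->
  esi_set e B.
Proof.
move=> sym_e dSL /subsetP BL extB; apply/andP; split.
  apply/forall_inP => x xB; apply/forall_inP => y yB; apply/negP => exy.
  have yS : y \in supports e by apply/supportP; exists x; first exact: BL.
  by have /negP[] := disjointFr dSL yS; exact: BL.
apply/forall_inP => v; rewrite inE => /andP[vB /set_closed_nbhdP[vB'|[b bB ebv]]].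
  by rewrite vB' in vB.
(* A neighbor of a leaf is a support vertex, so [extB] covers all of [N(B)]. *)
have vS : v \in supports e by apply/supportP; exists b; first exact: BL.
have [x [evx xB Nx]] := extB v vS.
apply/exists_inP; exists x => //; rewrite !inE andbT.
apply/negP => /set_closed_nbhdP[|[y yB eyx]]; first exact/negP.
by have := Nx y yB; rewrite eyx.
Qed.

(** The default [w] is returned only when [w] is not a support vertex. *)
Definition leaf_at (V : finType) (e : rel V) (w : V) : V :=
  odflt w [pick u | (u \in leaves e) && e u w].

Lemma leaf_atP (V : finType) (e : rel V) (w : V) :
  w \in supports e -> leaf_at e w \in leaves e /\ e (leaf_at e w) w.
Proof.
move=> /supportP[u uL euw]; rewrite /leaf_at; case: pickP => [x /andP[]//|/(_ u)].
by rewrite uL euw.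
Qed.

Lemma alpha_es_geq_leaves (V : finType) (e : rel V) :
    symmetric e -> [disjoint supports e & leaves e] ->
  num_leaves e <= alpha_es e + num_supports e.
Proof.
move=> sym_e dSL; set R := leaf_at e @: supports e.
have : esi_set e (leaves e :\: R).
  apply: esi_set_leaves => // [|w wS]; first exact: subsetDl.
  have [rL erw] := leaf_atP wS.
  exists (leaf_at e w); split; first by rewrite sym_e.
    by rewrite inE imset_f.
  (* The only neighbor of the deleted leaf is [w], which is not a leaf. *)
  move=> y /setDP[yL _]; apply/negP => eyr.
  have wy : w = y by apply: leaf_neighbor_uniq rL erw _; rewrite sym_e.
  by have := disjointFr dSL wS; rewrite wy yL.
move=> /esi_set_leq_alpha; have := leq_imset_card (leaf_at e) (supports e).
have := subset_leq_card (subsetIr (leaves e) R).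
rewrite cardsD -/R /num_leaves /num_supports; lia.
Qed.

Lemma alpha_es_geq_at (V : finType) (e : rel V) (v : V) :
    symmetric e -> irreflexive e -> [disjoint supports e & leaves e] ->
    v \notin leaves e ->
  num_leaves e + num_supports_at e v + (v \in supports e)
    <= alpha_es e + num_supports e + num_leaves_at e v.
Proof.
move=> sym_e irr_e dSL vL.
set S' := (supports e :\: nbhd e v) :\ v.
set R := leaf_at e @: S' :|: (nbhd e v :&: leaves e).
have : esi_set e (leaves e :\: R).
  apply: esi_set_leaves => // [|w wS]; first exact: subsetDl.
  have [evw|nevw] := boolP (e v w).
    exists v; split; [by rewrite sym_e | by rewrite inE (negbTE vL) andbF | ].
    move=> y /setDP[yL yR]; apply: contra yR => eyv.
    by rewrite in_setU in_setI in_nbhd sym_e eyv yL orbT.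
  have [rL erw] := leaf_atP wS.
  exists (leaf_at e w); split; first by rewrite sym_e.
    apply/negP => /setDP[_ /negP[]]; rewrite in_setU.
    (* For [w = v] the leaf was deleted with all leaves at [v]; otherwise [w] lies in [S']. *)
    have [wv|wv] := eqVneq w v.
      by rewrite in_setI rL in_nbhd sym_e -[X in e _ X]wv erw orbT.
    by rewrite imset_f // in_setD1 in_setD in_nbhd wv nevw.
  move=> y /setDP[yL _]; apply/negP => eyr.
  have wy : w = y by apply: leaf_neighbor_uniq rL erw _; rewrite sym_e.
  by have := disjointFr dSL wS; rewrite wy yL.
move=> /esi_set_leq_alpha.
have := leq_imset_card (leaf_at e) S'.
have := subset_leq_card (subsetIr (leaves e) R).
have : #|R| <= #|leaf_at e @: S'| + #|nbhd e v :&: leaves e|.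
  by rewrite cardsU leq_subr.
(* As [v] is not its own neighbor, [S'] has [s - s(v)] elements, less one if [v] is a support
   vertex. *)
have := cardsD1 v (supports e :\: nbhd e v).
have := cardsID (nbhd e v) (supports e).
rewrite -/S' [_ :&: nbhd e v]setIC in_setD in_nbhd irr_e /= (cardsD (leaves e)).
rewrite /num_leaves /num_supports /num_supports_at /num_leaves_at; lia.
Qed.

(** * The upper bound by charging untaken leaves *)

Lemma sum_leaves_at_leq (V : finType) (e : rel V) (S X : {set V}) :
    symmetric e -> X \subset leaves e ->
  \sum_(v in S) #|nbhd e v :&: X| <= #|X|.
Proof.
move=> sym_e /subsetP XL.
have -> : \sum_(v in S) #|nbhd e v :&: X| = \sum_(v in S) \sum_(u in X) e v u.
  apply: eq_bigr => v _; rewrite -sum1_card big_mkcond [RHS]big_mkcond /=.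
  by apply: eq_bigr => u _; rewrite in_setI in_nbhd; case: (u \in X); case: (e v u).
(* Double counting: a leaf has a single neighbor, so it contributes at most once. *)
rewrite exchange_big /= -sum1_card; apply: leq_sum => u /XL uL.
have : #|nbhd e u| <= 1 by move: uL; rewrite inE => /eqP->.
apply: leq_trans; rewrite -sum1_card big_mkcond [X in _ <= X]big_mkcond /=.
by apply: leq_sum => v _; rewrite in_nbhd sym_e; case: (v \in S); case: (e u v).
Qed.

(** If a support vertex were in [B], its leaf would be in [N(B)] with its only neighbor inside
    [B]. *)
Lemma esi_set_disjoint_supports (V : finType) (e : rel V) (B : {set V}) :
  symmetric e -> esi_set e B -> [disjoint B & supports e].
Proof.
move=> sym_e /andP[/forall_inP indB /forall_inP extB].
rewrite disjoint_subset; apply/subsetP => v vB; rewrite inE.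
apply/negP => /supportP[u uL euv].
have uB : u \notin B.
  by apply/negP => uB; have /forall_inP/(_ _ vB) := indB u uB; rewrite euv.
have /extB/exists_inP[w] : u \in set_nbhd e B.
  rewrite inE uB; apply/set_closed_nbhdP; right.
  by exists v; rewrite // sym_e.
rewrite inE => /andP[/negP wB _] euw; apply: wB; apply/set_closed_nbhdP; left.
by rewrite (leaf_neighbor_uniq uL euw euv).
Qed.

Lemma alpha_es_leq (V : finType) (e : rel V) :
    symmetric e -> [set: V] = supports e :|: leaves e ->
    (forall v, v \in supports e -> num_supports_at e v < num_leaves_at e v) ->
  alpha_es e + num_supports e <= num_leaves e.
Proof.
move=> sym_e VSL s_lt_l.
suff esiP B : esi_set e B -> #|B| + num_supports e <= num_leaves e.
  have [B esiB <-] := alpha_es_attained e.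
  exact: esiP.
move=> esiB; have dBS := esi_set_disjoint_supports sym_e esiB.
have BL : B \subset leaves e.
  apply/subsetP => x xB; have := in_setT x.
  by rewrite VSL in_setU (disjointFr dBS xB).
have /andP[_ /forall_inP extB] := esiB.
(* [X] holds the untaken leaves. All leaves at a vertex of [A] are taken, and none at a vertex of
   [C]. *)
pose X := leaves e :\: B; pose m v := #|nbhd e v :&: X|.
pose A := [set v in supports e | m v == 0].
pose C := supports e :\: set_closed_nbhd e B.
have mC v : v \in C -> m v = num_leaves_at e v.
  move=> /setDP[_ vN]; apply: eq_card => u; rewrite !in_setI in_setD in_nbhd.
  case evu: (e v u) => //=; case: (boolP (u \in B)) => //= uB.
  case/negP: vN; apply/set_closed_nbhdP; right; exists u => //.
  by rewrite sym_e.
have m_ge v : v \in supports e ->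
    1 + (if v \in C then #|nbhd e v :&: A| else 0) <= m v + (v \in A).
  move=> vS; case: (boolP (v \in C)) => [vC|_].
    rewrite mC //; have := s_lt_l v vS.
    have : #|nbhd e v :&: A| <= num_supports_at e v.
      apply/subset_leq_card/setIS/subsetP => x; rewrite in_set.
      by case/andP.
    lia.
  by rewrite in_set vS; case: (m v).
(* The external neighbor of [a] in [A] is not a leaf, since all leaves at [a] are in [B]; so it lies
   in [C]. *)
have A_le : #|A| <= \sum_(v in C) #|nbhd e v :&: A|.
  apply: leq_trans (_ : #|\bigcup_(v in C) (nbhd e v :&: A)| <= _); last first.
    elim/big_rec2: _ => [|v n D _ leDn]; first by rewrite cards0.
    by rewrite cardsU; apply: leq_trans (leq_subr _ _) _; rewrite leq_add2l.
  apply/subset_leq_card/subsetP => a aA.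
  have /setIdP[aS /eqP/cards0_eq m0] := aA.
  have N0 u : e a u -> u \in leaves e -> u \in B.
    move=> eau uL; apply/negPn/negP => uB.
    by have := in_set0 u; rewrite -m0 in_setI in_nbhd eau in_setD uB uL.
  have /supportP[u uL eua] := aS.
  have uB : u \in B by apply: N0; rewrite // sym_e.
  have /extB/exists_inP[w /setDP[_ wN] eaw] : a \in set_nbhd e B.
    rewrite in_setD (disjointFl dBS aS); apply/set_closed_nbhdP; right.
    by exists u.
  have wS : w \in supports e.
    have := in_setT w; rewrite VSL in_setU => /orP[//|wL].
    by case/negP: wN; apply/set_closed_nbhdP; left; exact: N0.
  apply/bigcupP; exists w; first by rewrite in_setD wN.
  by rewrite in_setI in_nbhd sym_e eaw.
have XL : X \subset leaves e by exact: subsetDl.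
have := sum_leaves_at_leq (supports e) sym_e XL.
(* Summing [m_ge] and cancelling [#|A|] by [A_le] leaves at least [s] untaken leaves. *)
have sum_m : \sum_(v in supports e) (1 + (if v \in C then #|nbhd e v :&: A| else 0))
           <= \sum_(v in supports e) (m v + (v \in A)) by apply: leq_sum.
rewrite !big_split /= in sum_m.
have sumA : \sum_(v in supports e) (v \in A) = #|A|.
  rewrite -sum1_card big_mkcond [RHS]big_mkcond /=; apply: eq_bigr => v _.
  have [vA|_] := boolP (v \in A); last by case: ifP.
  by have /setIdP[-> _] := vA.
have sumC : \sum_(v in supports e) (if v \in C then #|nbhd e v :&: A| else 0)
          = \sum_(v in C) #|nbhd e v :&: A|.
  rewrite big_mkcond [RHS]big_mkcond; apply: eq_bigr => v _.
  by rewrite in_setD; case: (v \in supports e); rewrite ?andbF.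
rewrite sum1_card sumA sumC in sum_m.
have := cardsID B (leaves e); rewrite (setIidPr BL) -/X /num_leaves /num_supports.
rewrite /m in sum_m *; lia.
Qed.

(** * Trees: existence of a leaf, the case of [K_2], and covering by supports and leaves *)

Lemma acyclic_long_path (V : finType) (e : rel V) (x0 : V) (n : nat) :
    symmetric e -> irreflexive e -> acyclic e -> (forall v, 1 < #|nbhd e v|) ->
  exists x p, [/\ path e x p, uniq (x :: p) & size p = n].
Proof.
move=> sym_e irr_e acyc deg; elim: n => [|n [x [p [pth unq szp]]]].
  by exists x0, [::].
(* The path grows at its front by a neighbor [z] of [x] other than the next vertex. If [z] were on
   the path, it would close a cycle of length at least 3. *)
have /card_gt0P[z] : 0 < #|nbhd e x :\ head x p|.
  by have := cardsD1 (head x p) (nbhd e x); have := deg x; lia.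
rewrite in_setD1 in_nbhd => /andP[zh exz].
exists z, (x :: p); split; [by rewrite /= sym_e exz | | by rewrite /= szp].
rewrite cons_uniq unq andbT inE negb_or; apply/andP; split.
  by apply: contraTneq exz => ->; rewrite irr_e.
apply/negP => zp; case/path.splitP: zp zh pth unq => p1 p2 zh.
rewrite cat_path => /andP[pth _]; rewrite -cat_cons cat_uniq => /andP[unq _].
apply: (acyc (x :: rcons p1 z)); last first.
  by rewrite /ucycle unq andbT /= rcons_path pth last_rcons sym_e.
by case: p1 zh {pth unq} => [|y p1] /=; rewrite ?eqxx // size_rcons.
Qed.

Lemma connect_exit (V : finType) (e : rel V) (X : {set V}) (x y : V) :
    connect e x y -> x \in X -> y \notin X ->
  exists u v, [/\ u \in X, v \notin X & e u v].
Proof.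
move=> /connectP[p]; elim: p x => [|z p IHp] x /=; first by move=> _ -> ->.
move=> /andP[exz pth] yl xX yX.
have [zX|zX] := boolP (z \in X); first exact: IHp pth yl zX yX.
by exists x, z.
Qed.

Lemma tree_has_leaf (V : finType) (e : rel V) :
  tree e -> 1 < #|V| -> exists u, u \in leaves e.
Proof.
move=> [[sym_e irr_e] [_ conn] acyc] V_gt1.
have [L0|[u uL]] := set_0Vmem (leaves e); last by exists u.
have deg v : 1 < #|nbhd e v|.
  have : v \notin leaves e by rewrite L0 inE.
  rewrite inE; suff : 0 < #|nbhd e v| by case: #|_| => [|[]].
  have /card_gt0P[y yv] : 0 < #|predC1 v| by have := cardC1 v; lia.
  have [|a [b [/set1P-> _ evb]]] := connect_exit (X := [set v]) (conn v y) (set11 v).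
    by rewrite in_set1.
  by apply/card_gt0P; exists b; rewrite in_nbhd.
have /card_gt0P[x0 _] : 0 < #|V| by lia.
have [x [p [_ unq szp]]] := acyclic_long_path x0 #|V| sym_e irr_e acyc deg.
(* A path with [#|V|] edges has one vertex too many to be repetition-free. *)
by have := uniq_leq_size unq (fun z _ => mem_enum V z); rewrite -cardE /= szp ltnn.
Qed.

(** Two adjacent leaves have no further neighbors, so by connectivity they form the whole graph. *)
Lemma disjoint_supports_leaves (V : finType) (e : rel V) :
    symmetric e -> irreflexive e -> (forall x y, connect e x y) ->
  [disjoint supports e & leaves e] \/ #|V| = 2 /\ supports e = setT.
Proof.
move=> sym_e irr_e conn; case: (boolP [disjoint _ & _]); first by left.
rewrite -setI_eq0 => /set0Pn[x /setIP[xS xL]]; right.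
have /supportP[u uL eux] := xS.
have exu : e x u by rewrite sym_e.
have VE : [set: V] = [set u; x].
  apply/setP => y; rewrite in_setT; apply/esym/negPn/negP => yN.
  have [a [b [aX /negP bX eab]]] := connect_exit (conn u y) (set21 u x) yN.
  apply: bX; case/set2P: aX => aE; rewrite aE in eab.
    by rewrite (leaf_neighbor_uniq uL eab eux) set22.
  by rewrite (leaf_neighbor_uniq xL eab exu) set21.
split; first by rewrite -cardsT VE cards2; case: eqVneq eux => // ->; rewrite irr_e.
apply/eqP; rewrite -subTset VE; apply/subsetP => y /set2P[]-> //.
by apply/supportP; exists x.
Qed.

Lemma supports_leaves_cover (V : finType) (e : rel V) :
    tree e -> [disjoint supports e & leaves e] ->
    alpha_es e + num_supports e = num_leaves e ->
  [set: V] = supports e :|: leaves e.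
Proof.
move=> treeT dSL eqa; have [[sym_e irr_e] [V_gt0 conn] _] := treeT.
have [r rL] : exists u, u \in leaves e.
  (* A one-vertex tree has no leaf but is itself an ESI-set, against the assumed equality. *)
  have [V_gt1|V_le1] := ltnP 1 #|V|; first exact: tree_has_leaf.
  have /card_gt0P[v _] := V_gt0.
  have eqV (x y : V) : x = y by apply: (card_le1_eqP V_le1).
  have vL : v \notin leaves e.
    rewrite inE; apply/negP => /cards1P[u Nv].
    have evu : e v u by rewrite -in_nbhd Nv set11.
    by rewrite (eqV u v) irr_e in evu.
  have L0 : num_leaves e = 0.
    apply/eqP; rewrite cards_eq0; apply/eqP/setP => u; rewrite in_set0.
    by rewrite (eqV u v) (negbTE vL).
  have : esi_set e [set: V].
    apply/andP; split; last by apply/forall_inP => x; rewrite inE in_setT.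
    apply/forall_inP => x _; apply/forall_inP => y _.
    by rewrite (eqV y x) irr_e.
  by move=> /esi_set_leq_alpha; rewrite cardsT; lia.
apply/eqP; rewrite eq_sym -subTset; apply/subsetP => y _; apply/negPn/negP => yN.
have rSL : r \in supports e :|: leaves e by rewrite in_setU rL orbT.
(* Here [b] has a support neighbor [a] but no leaf neighbor, so [alpha_es_geq_at] at [b] makes the
   bound strict. *)
have [a [b [aSL + eab]]] := connect_exit (conn r y) rSL yN.
rewrite in_setU => /norP[bS bL].
have aS : a \in supports e.
  case/setUP: aSL => // aL; case/negP: bS.
  by apply/supportP; exists a.
have := alpha_es_geq_at sym_e irr_e dSL bL.
have : 0 < num_supports_at e b.
  by apply/card_gt0P; exists a; rewrite in_setI in_nbhd sym_e eab.
have -> : num_leaves_at e b = 0.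
  apply/eqP; rewrite cards_eq0; apply/eqP/setP => u; rewrite in_set0 in_setI.
  apply/negP => /andP[]; rewrite in_nbhd sym_e => eub uL; case/negP: bS.
  by apply/supportP; exists u.
lia.
Qed.

End ExternallySupported.

Theorem theorem16 (V : finType) (e : rel V) (treeT : tree e) :
  (num_leaves e)%:Z - (num_supports e)%:Z <= (alpha_es e)%:Z
  /\ (#|V| <> 2%N ->
      ((alpha_es e)%:Z = (num_leaves e)%:Z - (num_supports e)%:Z
       <-> [set: V] = supports e :|: leaves e
           /\ (forall v : V, v \in supports e ->
                 (num_supports_at e v)%:Z <= (num_leaves_at e v)%:Z - 1))).
Proof.
have [[sym_e irr_e] [_ conn] _] := treeT.
have [dSL|[V2 ST]] := disjoint_supports_leaves sym_e irr_e conn; last first.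
  (* In [K_2] every vertex is a support vertex, so the difference is at most 0. *)
  split=> // {V2}; have := max_card (leaves e).
  by rewrite /num_leaves /num_supports ST cardsT; lia.
have lower := alpha_es_geq_leaves sym_e dSL.
split=> [|_]; first by lia.
split=> [eqa|[VSL s_lt_l]].
  split=> [|v vS]; first by apply: supports_leaves_cover => //; lia.
  have vL : v \notin leaves e by rewrite (disjointFr dSL vS).
  by have := alpha_es_geq_at sym_e irr_e dSL vL; rewrite vS; lia.
suff : (alpha_es e + num_supports e <= num_leaves e)%N by lia.
by apply: alpha_es_leq => // v /s_lt_l; lia.
Qed.
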